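(* Let $G\in H^\infty_{m\times p}$ and assume that $T_GT_G^*$ is strictly positive. Let $\Xi_0=E_p^*T_G^*(T_GT_G^* )^{-1}E_m$, and let $\Theta_0$ be a $p\times k$ matrix with $$\Theta_0\Theta_0^*=I_p-E_p^*T_G^*(T_GT_G^* )^{-1}T_GE_p,\quad\operatorname{Ker}\Theta_0=\{0\}.$$ Then the matrix $\begin{bmatrix}\Xi_0&\Theta_0\end{bmatrix}$ is invertible with inverse given by $$\begin{bmatrix}\Xi_0&\Theta_0\end{bmatrix}^{-1}=\begin{bmatrix}G_0\\ H_0\end{bmatrix}\quad\text{with}\quad H_0=(\Theta_0^*\Theta_0)^{-1}\Theta_0^*(I_p-\Xi_0G_0).$$ In particular, we have $k=p-m$ and $\operatorname{Im}\Theta_0=\operatorname{Ker}G_0$.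
   Context: $\mathbb{D}$ is the open unit disc. $H^\infty_{m\times p}$ is the space of $m\times p$ matrices with entries in $H^\infty$ of $\mathbb{D}$. $\ell^2_+(\mathbb{C}^n)$ is the space of square summable sequences in $\mathbb{C}^n$ indexed by $0,1,2,\ldots$ For $G\in H^\infty_{m\times p}$ with Taylor coefficients $G_0,G_1,\ldots$ at zero, $T_G:\ell^2_+(\mathbb{C}^p)\to\ell^2_+(\mathbb{C}^m)$ is the analytic Toeplitz operator whose $(i,j)$ block entry ($i,j\ge0$) is $G_{i-j}$ if $i\ge j$ and $0$ otherwise. A selfadjoint operator is strictly positive if it is $\ge\delta I$ for some $\delta>0$. $E_n=\begin{bmatrix}I_n&0&0&\cdots\end{bmatrix}^\top:\mathbb{C}^n\to\ell^2_+(\mathbb{C}^n)$ is the embedding onto the first coordinate space. *)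

(* Defs.v *)
From HB Require Import structures.
From mathcomp Require Import all_boot all_order all_algebra.
From mathcomp Require Import all_classical all_reals all_analysis.
From mathcomp Require Export spectral complex.

Set Implicit Arguments.
Unset Strict Implicit.
Unset Printing Implicit Defensive.

Import Order.TTheory GRing.Theory Num.Theory.
Import numFieldNormedType.Exports.

Local Open Scope classical_set_scope.
Local Open Scope ring_scope.
Local Open Scope complex_scope.
Local Open Scope sesquilinear_scope.

Section Hinfty.
Variables (R : realType) (m p : nat).
Local Notation C := R[i].
Implicit Types G : C -> 'M[C]_(m, p).

(* [C^o] is [C] seen as a normed space over itself, so that [derivable _ z 1]
   is complex differentiability at [z].  The values of [G] outside the open
   unit disc play no role. *)
Definition entry G (i : 'I_m) (j : 'I_p) : C^o -> C^o := fun z => G z i j.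

Definition Hinfty G : Prop :=
  forall i j,
    (forall z : C, `|z| < 1 -> derivable (entry G i j) z 1) /\
    (exists M : C, forall z : C, `|z| < 1 -> `|G z i j| <= M).

Definition taylor G (n : nat) : 'M[C]_(m, p) :=
  \matrix_(i, j) ((n`!%:R)^-1 * derive1n n (entry G i j) 0).

End Hinfty.

(* Operators are represented by functions on all sequences of column vectors;
   only their restrictions to the square summable ones are meaningful. *)
Definition vseq (R : realType) (n : nat) : Type := nat -> 'cV[R[i]]_n.

Section Sequences.
Variables (R : realType) (n : nat).
Local Notation C := R[i].
Implicit Types x y : vseq R n.

(* General term of <x, y>, linear in the first argument. *)
Definition l2term x y : nat -> C^o := fun j => ((y j)^t* *m x j) 0 0.

Definition l2 x : Prop := cvgn (series (l2term x x)).

Definition l2dot x y : C := limn (series (l2term x y)).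

(* [emb] is E_n, and [proj0] is its adjoint E_n^*. *)
Definition emb (v : 'cV[C]_n) : vseq R n := fun j => if j is 0%N then v else 0.

Definition proj0 x : 'cV[C]_n := x 0%N.

End Sequences.

Section Operators.
Variable R : realType.
Local Notation C := R[i].

(* [T] induces a bounded linear operator on square summable sequences. *)
Definition bounded_op n m (T : vseq R n -> vseq R m) : Prop :=
  [/\ forall x, l2 x -> l2 (T x),
      forall (a : C) x y, l2 x -> l2 y ->
        T (fun j => a *: x j + y j) = (fun j => a *: T x j + T y j) &
      exists M : R, forall x, l2 x ->
        l2dot (T x) (T x) <= M%:C * l2dot x x].

Definition is_adjoint n m (T : vseq R n -> vseq R m) (S : vseq R m -> vseq R n)
    : Prop :=
  [/\ bounded_op T, bounded_op S &
      forall x y, l2 x -> l2 y -> l2dot (T x) y = l2dot x (S y)].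

Definition is_inverse n (A B : vseq R n -> vseq R n) : Prop :=
  [/\ bounded_op A, bounded_op B &
      forall x, l2 x -> A (B x) = x /\ B (A x) = x].

(* Both are unique on square summable sequences when they exist; the value is
   the zero operator when they do not. *)
Definition adjoint n m (T : vseq R n -> vseq R m) : vseq R m -> vseq R n :=
  if pselect (exists S, is_adjoint T S) is left h then sval (cid h)
  else fun _ _ => 0.

Definition inverse n (A : vseq R n -> vseq R n) : vseq R n -> vseq R n :=
  if pselect (exists B, is_inverse A B) is left h then sval (cid h)
  else fun _ _ => 0.

(* [is_adjoint A A] says that [A] is a bounded selfadjoint operator. *)
Definition strictly_positive n (A : vseq R n -> vseq R n) : Prop :=
  is_adjoint A A /\
  exists2 delta : R, 0 < delta &
    forall x, l2 x -> delta%:C * l2dot x x <= l2dot (A x) x.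

(* The block Toeplitz matrix is lower triangular, so its action on a sequence
   is given by finite sums. *)
Definition toeplitz m p (F : nat -> 'M[C]_(m, p)) : vseq R p -> vseq R m :=
  fun x i => \sum_(j < i.+1) F (i - j)%N *m x j.

(* The matrix of a linear map between spaces of column vectors. *)
Definition mx_of n m (f : 'cV[C]_n -> 'cV[C]_m) : 'M[C]_(m, n) :=
  \matrix_(i, j) f (delta_mx j 0) i 0.

End Operators.

Arguments emb {R} n v _.
Arguments proj0 {R} n x.

(* Main.v *)
Require Import Defs.
From mathcomp Require Import all_boot all_order all_algebra.
From mathcomp Require Import all_classical all_reals all_analysis.
From mathcomp Require Import ring lra.
Set Implicit Arguments.
Unset Strict Implicit.
Unset Printing Implicit Defensive.
Import Order.TTheory GRing.Theory Num.Theory.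
Import numFieldNormedType.Exports.
Local Notation Re := complex.Re.
Local Notation Im := complex.Im.
Local Open Scope classical_set_scope.
Local Open Scope ring_scope.
Local Open Scope complex_scope.
Local Open Scope sesquilinear_scope.

(** Write T for the Toeplitz operator of the Taylor coefficients of G, A for
    T T^* and E for the embedding onto the first coordinate.  Everything rests
    on two features of T: it is lower triangular, so that (T x)_0 = G_0 x_0,
    and it commutes with the forward shift S.

    Since T T^* A^-1 = 1, reading off coordinate 0 gives G_0 Xi_0 = 1
    ([taylor0_Xi]).  Also Theta_0 Theta_0^* = E^* (1 - P) E, where
    P = T^* A^-1 T satisfies T (1 - P) = 0; coordinate 0 again gives
    G_0 Theta_0 Theta_0^* = 0, hence G_0 Theta_0 = 0 because
    Theta_0^* Theta_0 is invertible.

    The heart of the matter is the converse inclusion, that Ker G_0 contains no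
    nonzero vector u orthogonal to Im Theta_0 ([defect_inj]).  For such a u,
    0 = <(1 - P) E u, E u> = |(1 - P) E u|^2, so E u = P E u = T^* z for some z.
    The backward shift S^* commutes with T^* and kills E u, so T^* S^* z = 0;
    as T^* is injective, S^* z = 0, that is, z = E z_0
    ([embedded_adjoint_preimage]).  Then
    |u|^2 = <E u, T^* z> = <T E u, E z_0> = <G_0 u, z_0> = 0.

    What remains is linear algebra: the orthogonal projection onto Im Theta_0
    is the identity on Ker G_0, which contains the columns of 1 - Xi_0 G_0, and
    this makes both products of block matrices equal to the identity; the
    dimension count follows.

    The analytic input is that A^-1 exists.  A bounded operator A with
    Re <A x, x> >= delta |x|^2 is injective with closed range, and
    1 - t A is a strict contraction for small t > 0, so the Neumann series
    converges and A is onto ([coercive_onto], [coercive_inverse]); this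
    uses the completeness of square summable sequences ([l2_complete]).
    Finally T^* exists: were there no adjoint, the convention
    T^* = 0 would force A to be constant, and strict positivity would leave
    only the zero space, where 0 is an adjoint
    ([strictly_positive_adjoint]). *)

(** * Limits in the complex plane *)

Section ComplexLimits.
Variable R : realType.
Local Notation C := R[i].

Lemma cvg_Re (u : nat -> C^o) (l : C) :
  u @ \oo --> (l : C^o) -> (fun n => Re (u n)) @ \oo --> Re l.
Proof.
move=> /cvgrPdist_lt ul; apply/cvgrPdist_lt => e e0.
have /ul : 0 < e%:C :> C by rewrite ltcR.
apply: filterS => n ltn; rewrite -raddfB /= -ltcR.
exact: le_lt_trans (normc_ge_Re _) ltn.
Qed.

Lemma cvg_conj (u : nat -> C^o) (l : C) :
  u @ \oo --> (l : C^o) ->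
  (fun n => Num.conj (u n) : C^o) @ \oo --> (Num.conj l : C^o).
Proof.
move=> /cvgrPdist_lt ul; apply/cvgrPdist_lt => e e0.
by apply: filterS (ul e e0) => n; rewrite -rmorphB norm_conjC.
Qed.

Lemma cvg_realC (u : nat -> R) (l : R) :
  u @ \oo --> l -> (fun n => (u n)%:C : C^o) @ \oo --> (l%:C : C^o).
Proof.
move=> /cvgrPdist_lt ul; apply/cvgrPdist_lt => e e0.
have e_re : e = (Re e)%:C by rewrite RRe_real// gtr0_real.
have re0 : 0 < Re e by rewrite -ltcR -e_re.
apply: filterS (ul _ re0) => n ltn.
rewrite -rmorphB normc_def /= expr0n addr0 sqrtr_sqr e_re ltcR //.
Qed.

End ComplexLimits.

(** * Square summable sequences *)

Section Csq.
Variable R : realType.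
Local Notation C := R[i].
Variable n : nat.
Implicit Types (v w : 'cV[C]_n).

(** A real number where [l2dot] has complex values, so that monotone convergence
    and the order of the reals apply. *)
Definition csq v : R := \sum_i (Re (v i 0) ^+ 2 + Im (v i 0) ^+ 2).

Lemma csqE v : (v^t* *m v) 0 0 = (csq v)%:C.
Proof.
rewrite mxE rmorph_sum; apply: eq_bigr => i _ /=.
by rewrite !mxE add_Re2_Im2 mulrC -normCK.
Qed.

Lemma csq_ge0 v : 0 <= csq v.
Proof. by apply: sumr_ge0 => i _; rewrite addr_ge0 ?sqr_ge0. Qed.

Lemma csq0 : csq 0 = 0.
Proof. by rewrite /csq big1 // => i _; rewrite mxE /= expr0n addr0. Qed.

Lemma csq_eq0 v : csq v = 0 -> v = 0.
Proof.
move=> /eqP; rewrite psumr_eq0 => [/allP v0|i _]; last by rewrite addr_ge0 ?sqr_ge0.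
apply/matrixP => i j; rewrite ord1 [RHS]mxE.
have := v0 i (mem_index_enum _); rewrite paddr_eq0 ?sqr_ge0 // !sqrf_eq0 /=.
by case: (v i 0) => a b /= /andP[/eqP-> /eqP->].
Qed.

Lemma csqZ a v : csq (a *: v) = (Re a ^+ 2 + Im a ^+ 2) * csq v.
Proof.
rewrite /csq mulr_sumr; apply: eq_bigr => i _; rewrite mxE.
by case: a (v i 0) => a b [c d] /=; ring.
Qed.

Lemma csqN v : csq (- v) = csq v.
Proof. by rewrite -scaleN1r csqZ /= oppr0 expr0n addr0 sqrrN expr1n mul1r. Qed.

Lemma csqD_le v w : csq (v + w) <= 2 * csq v + 2 * csq w.
Proof.
rewrite /csq !mulr_sumr -big_split /=; apply: ler_sum => i _; rewrite mxE.
case: (v i 0) (w i 0) => a b [c d] /=.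
have := sqr_ge0 (a - c); have := sqr_ge0 (b - d); rewrite !expr2.
lra.
Qed.

End Csq.

Section Ell2.
Variables (R : realType) (n : nat).
Local Notation C := R[i].
Implicit Types x y z : vseq R n.

(** The combinations in which [bounded_op] expresses linearity; the difference
    y - x is [axpy (-1) x y]. *)
Definition axpy (a : C) x y : vseq R n := fun j => a *: x j + y j.

Lemma axpyE a x y j : axpy a x y j = a *: x j + y j.
Proof. by []. Qed.

(** The squared norm as a real number; [l2dotxx] shows that taking the real part
    loses nothing. *)
Definition sqn x : R := Re (l2dot x x).

Lemma series_l2term x N :
  series (l2term x x) N = (series (fun j => csq (x j)) N)%:C.
Proof.
by rewrite /series /= rmorph_sum; apply: eq_bigr => j _; rewrite /l2term csqE.
Qed.

Lemma nd_series_csq x : nondecreasing_seq (series (fun j => csq (x j))).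
Proof. by apply: nondecreasing_series => j _ _; exact: csq_ge0. Qed.

Lemma l2_cvg x : l2 x -> series (fun j => csq (x j)) @ \oo --> sqn x.
Proof.
move=> x2; have /cvg_Re := x2; apply: cvg_trans.
by rewrite (_ : (fun _ => Re _) = series (fun j => csq (x j)))//;
  apply/funext => N; rewrite series_l2term.
Qed.

Lemma l2dot_lim x y (l : C) :
  series (l2term x y) @ \oo --> (l : C^o) -> l2dot x y = l.
Proof. exact: (cvg_lim (@norm_hausdorff _ _)). Qed.

Lemma l2dotxx x : l2 x -> l2dot x x = (sqn x)%:C.
Proof.
move=> /l2_cvg/cvg_realC H; apply: l2dot_lim.
have -> : series (l2term x x) = fun N => (series (fun j => csq (x j)) N)%:C.
  by apply/funext => N; rewrite series_l2term.
exact: H.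
Qed.

(** The terms of |x|^2 are nonnegative, so bounded partial sums suffice. *)
Lemma l2_bounded x (M : R) : (forall N, series (fun j => csq (x j)) N <= M) ->
  l2 x /\ sqn x <= M.
Proof.
move=> xM; have x2 : l2 x.
  have : cvgn (series (fun j => csq (x j))).
    apply: nondecreasing_is_cvgn; first exact: nd_series_csq.
    by exists M => _ [N _ <-].
  move=> /cvg_realC H; apply/cvg_ex.
  exists (limn (series (fun j => csq (x j))))%:C.
  by rewrite (_ : series _ = fun N => (series (fun j => csq (x j)) N)%:C)//;
    apply/funext => N; rewrite series_l2term.
split => //; rewrite -(cvg_lim (@Rhausdorff R) (l2_cvg x2)).
apply: limr_le; first by apply/cvg_ex; exists (sqn x); exact: l2_cvg.
exact: nearW.
Qed.

Lemma sqn_ge x N : l2 x -> series (fun j => csq (x j)) N <= sqn x.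
Proof.
move=> x2; rewrite -(cvg_lim (@Rhausdorff R) (l2_cvg x2)).
apply: nondecreasing_cvgn_le; first exact: nd_series_csq.
by apply/cvg_ex; exists (sqn x); exact: l2_cvg.
Qed.

Lemma csq_le_sqn x j : l2 x -> csq (x j) <= sqn x.
Proof.
move=> x2; apply: le_trans (sqn_ge j.+1 x2).
by rewrite /series /= big_nat_recr //= lerDr sumr_ge0 // => i _; exact: csq_ge0.
Qed.

Lemma sqn_ge0 x : l2 x -> 0 <= sqn x.
Proof. by move=> x2; apply: le_trans (csq_ge0 (x 0%N)) (csq_le_sqn 0 x2). Qed.

Lemma sqn_eq0 x : l2 x -> sqn x <= 0 -> x = fun=> 0.
Proof.
move=> x2 x0; apply/funext => j; apply: csq_eq0; apply/eqP.
by rewrite eq_le csq_ge0 (le_trans (csq_le_sqn j x2)).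
Qed.

Lemma l2_axpy a x y : l2 x -> l2 y -> l2 (axpy a x y).
Proof.
move=> x2 y2; set c := Re a ^+ 2 + Im a ^+ 2.
have c0 : 0 <= c by rewrite addr_ge0 ?sqr_ge0.
suff /l2_bounded[] : forall N, series (fun j => csq (axpy a x y j)) N
    <= 2 * (c * sqn x) + 2 * sqn y by [].
move=> N; apply: (@le_trans _ _ (2 * (c * series (fun j => csq (x j)) N)
    + 2 * series (fun j => csq (y j)) N)).
  rewrite /series /= !mulr_sumr -big_split /=; apply: ler_sum => j _.
  by rewrite -csqZ; exact: csqD_le.
by rewrite lerD // ler_wpM2l // ?sqn_ge// ler_wpM2l// sqn_ge.
Qed.

Lemma l2_fin x N : (forall j, (N <= j)%N -> x j = 0) -> l2 x.
Proof.
move=> x0; suff /l2_bounded[] : forall M, series (fun j => csq (x j)) M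
    <= series (fun j => csq (x j)) N by [].
move=> M; case: (leqP M N) => [/nd_series_csq//|/ltnW NM].
rewrite /series /= [leLHS](big_cat_nat _ NM) //= gerDl big_nat.
by rewrite big1 // => j /andP[Nj _]; rewrite x0 // csq0.
Qed.

Lemma l2term_axpyl a x y z j :
  l2term (axpy a x y) z j = a * l2term x z j + l2term y z j.
Proof. by rewrite /l2term mulmxDr -scalemxAr !mxE. Qed.

Lemma l2termC x y j : l2term y x j = Num.conj (l2term x y j).
Proof.
rewrite /l2term !mxE rmorph_sum; apply: eq_bigr => i _.
by rewrite !mxE rmorphM /= conjCK mulrC.
Qed.

Lemma l2term_axpyr a x y z j :
  l2term z (axpy a x y) j = Num.conj a * l2term z x j + l2term z y j.
Proof.
by rewrite l2termC l2term_axpyl rmorphD rmorphM /= -!l2termC.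
Qed.

(** Polarization reduces the convergence of the series <x, y> to that of
    squared norms. *)
Lemma l2term_polar x y : l2term x y = fun j =>
  4^-1 * l2term (axpy 1 y x) (axpy 1 y x) j
   + (- 4^-1 * l2term (axpy (-1) y x) (axpy (-1) y x) j
   + ('i%C / 4 * l2term (axpy 'i%C y x) (axpy 'i%C y x) j
   + (- 'i%C / 4 * l2term (axpy (- 'i%C) y x) (axpy (- 'i%C) y x) j + 0))).
Proof.
apply/funext => j.
pose f (c d : C) : C := c * (d * l2term y y j + l2term y x j)
      + (d * l2term x y j + l2term x x j).
have E (c d : C) : Num.conj c = d ->
    l2term (axpy c y x) (axpy c y x) j = f c d.
  by move=> <-; rewrite l2term_axpyl !l2term_axpyr.
have cN (c d : C) : Num.conj c = d -> Num.conj (- c) = - d.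
  by move=> <-; exact: rmorphN.
have c1 : Num.conj (1 : C) = 1 by exact: rmorph1.
have ci : Num.conj ('i%C : C) = - 'i%C.
  by apply/eqP; rewrite eq_complex /= oppr0 !eqxx.
(* Syntactically matching the four similar terms by rewriting would make
   unification compute with the complex numbers 1, -1, i and -i. *)
suff H q1 qn1 qi qni : q1 = f 1 1 ->
    qi = f 'i%C (- 'i%C) -> qn1 = f (-1) (-1) -> qni = f (- 'i%C) (- - 'i%C) ->
    l2term x y j = 4^-1 * q1 + (- 4^-1 * qn1 + ('i%C / 4 * qi
      + (- 'i%C / 4 * qni + 0))).
  exact: H (E _ _ c1) (E _ _ ci) (E _ _ (cN _ _ c1)) (E _ _ (cN _ _ ci)).
move=> -> -> -> ->; rewrite /f; have := sqr_i R; move: ('i%C : C) => I i2.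
by field: i2.
Qed.

Lemma cvg_series_axpy (a : C) (u v : nat -> C^o) :
  cvgn (series u) -> cvgn (series v) ->
  cvgn (series (fun j => a * u j + v j : C^o)).
Proof.
move=> cu cv; apply/cvg_ex; eexists.
rewrite (_ : series _ = fun N => a * series u N + series v N).
  by apply: cvgD; [apply: cvgMr; exact: cu|exact: cv].
by apply/funext => N; rewrite /series /= mulr_sumr -big_split.
Qed.

Lemma cvg_l2dot x y : l2 x -> l2 y ->
  series (l2term x y) @ \oo --> (l2dot x y : C^o).
Proof.
move=> x2 y2; suff : cvgn (series (l2term x y)) by [].
have P c : cvgn (series (l2term (axpy c y x) (axpy c y x))).
  exact: l2_axpy.
rewrite l2term_polar; do 4!(apply: cvg_series_axpy; first exact: P).
apply/cvg_ex; exists 0; rewrite (_ : series _ = fun=> 0); first exact: cvg_cst.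
by apply/funext => N; rewrite /series /= big1.
Qed.

Lemma l2dot_axpyl a x y z : l2 x -> l2 y -> l2 z ->
  l2dot (axpy a x y) z = a * l2dot x z + l2dot y z.
Proof.
move=> x2 y2 z2; apply: l2dot_lim.
rewrite (_ : series _ =
    fun N => a * series (l2term x z) N + series (l2term y z) N).
  by apply: cvgD; [apply: cvgMr|]; exact: cvg_l2dot.
apply/funext => N; rewrite /series /= mulr_sumr -big_split /=.
by apply: eq_bigr => j _; rewrite l2term_axpyl.
Qed.

Lemma l2dotC x y : l2 x -> l2 y -> l2dot y x = Num.conj (l2dot x y).
Proof.
move=> x2 y2; apply: l2dot_lim.
rewrite (_ : series _ = fun N => Num.conj (series (l2term x y) N)).
  by apply: cvg_conj; exact: cvg_l2dot.
apply/funext => N; rewrite /series /= rmorph_sum.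
by apply: eq_bigr => j _; exact: l2termC.
Qed.

Lemma l2dot_axpyr a x y z : l2 x -> l2 y -> l2 z ->
  l2dot z (axpy a x y) = Num.conj a * l2dot z x + l2dot z y.
Proof.
move=> x2 y2 z2; rewrite (l2dotC (@l2_axpy a _ _ x2 y2) z2) l2dot_axpyl //.
by rewrite rmorphD rmorphM /= -(l2dotC x2 z2) -(l2dotC y2 z2).
Qed.

Lemma sqn_axpy (t : R) x y : l2 x -> l2 y ->
  sqn (axpy t%:C x y) = t ^+ 2 * sqn x + 2 * t * Re (l2dot x y) + sqn y.
Proof.
move=> x2 y2; have xy := @l2_axpy t%:C _ _ x2 y2.
apply: complexI; rewrite -l2dotxx // l2dot_axpyl // !l2dot_axpyr //.
rewrite (l2dotC x2 y2) !l2dotxx //.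
have -> : Num.conj (t%:C) = t%:C :> C by exact: conjc_real.
apply/eqP; rewrite eq_complex; case: (l2dot x y) => a b /=.
by apply/andP; split; apply/eqP; ring.
Qed.

Lemma sqnB_le x y : l2 x -> l2 y -> sqn (axpy (-1) x y) <= 2 * sqn x + 2 * sqn y.
Proof.
move=> x2 y2; have /l2_bounded[] // :
    forall N, series (fun j => csq (axpy (-1) x y j)) N <= 2 * sqn x + 2 * sqn y.
move=> N; apply: (@le_trans _ _ (2 * series (fun j => csq (x j)) N
    + 2 * series (fun j => csq (y j)) N)).
  rewrite /series /= !mulr_sumr -big_split /=; apply: ler_sum => j _.
  by rewrite /axpy scaleN1r -[csq (x j)]csqN; exact: csqD_le.
by rewrite lerD // ler_wpM2l // sqn_ge.
Qed.

Lemma l2dot_fin x y N : (forall j, (N <= j)%N -> l2term x y j = 0) ->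
  l2dot x y = \sum_(0 <= j < N) l2term x y j.
Proof.
move=> xy0; apply: l2dot_lim.
apply: cvg_near_cst; exists N => // M /= NM.
rewrite /series /= (big_cat_nat _ NM) //= [X in _ + X](_ : _ = 0) ?addr0 //.
by rewrite big_nat big1 // => j /andP[Nj _]; exact: xy0.
Qed.

Lemma l2_0 : l2 (fun=> 0 : 'cV[C]_n).
Proof. exact: (@l2_fin _ 0%N). Qed.

Lemma l2dot0r x : l2dot x (fun=> 0) = 0.
Proof.
rewrite (@l2dot_fin _ _ 0%N) ?big_geq // => j _.
by rewrite /l2term trmx0 map_mx0 mul0mx mxE.
Qed.

Lemma l2dot0l x : l2dot (fun=> 0) x = 0.
Proof.
by rewrite (@l2dot_fin _ _ 0%N) ?big_geq // => j _; rewrite /l2term mulmx0 mxE.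
Qed.

Lemma sqn0 : sqn (fun=> 0 : 'cV[C]_n) = 0.
Proof. by rewrite /sqn l2dot0r. Qed.

Lemma l2_emb (v : 'cV[C]_n) : l2 (emb n v).
Proof. by apply: (@l2_fin _ 1%N) => -[]. Qed.

Lemma l2dot_embr x (v : 'cV[C]_n) : l2dot x (emb n v) = (v^t* *m x 0%N) 0 0.
Proof.
rewrite (@l2dot_fin _ _ 1%N) ?big_nat1 // => -[] // j _.
by rewrite /l2term /= trmx0 map_mx0 mul0mx mxE.
Qed.

End Ell2.

(** * Completeness *)

Section Completeness.
Variable R : realType.

Lemma cvg_sqdist (u eps : nat -> R) : eps @ \oo --> 0 ->
  (forall N M, (N <= M)%N -> (u M - u N) ^+ 2 <= eps N) -> cvgn u.
Proof.
move=> eps0 ueps; apply/cauchy_cvgP/cauchy_exP => e e0.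
have e20 : 0 < e ^+ 2 by rewrite exprn_gt0.
have [N _ Ne] := (@cvgrPdist_lt _ _ _ _ _ _ _).1 eps0 _ e20.
exists (u N); exists N => // M /= NM; rewrite -ball_normE /= distrC.
rewrite -(ltr_pXn2r (ltn0Sn 1)) ?nnegrE // ?(ltW e0) // -normrX ger0_norm ?sqr_ge0 //.
apply: le_lt_trans (ueps _ _ NM) _; apply: le_lt_trans (Ne N (leqnn N)).
by rewrite sub0r normrN ler_norm.
Qed.

Lemma cvg_sumR (I : Type) (r : seq I) (u : I -> nat -> R) (l : I -> R) :
  (forall i, u i @ \oo --> l i) ->
  (fun N => \sum_(i <- r) u i N) @ \oo --> \sum_(i <- r) l i.
Proof. by move=> ul; apply: cvg_big => [|i _]; [exact: add_continuous|exact: ul]. Qed.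

(** Each entry is a Cauchy sequence, which produces the limit; the bound passes
    to the limit first in the partial sums of the squared distance, and from
    them to their supremum. *)
Lemma l2_complete n (s : nat -> vseq R n) (eps : nat -> R) :
  eps @ \oo --> 0 -> (forall N, l2 (s N)) ->
  (forall N M, (N <= M)%N -> sqn (axpy (-1) (s N) (s M)) <= eps N) ->
  exists2 x, l2 x & forall N, l2 (axpy (-1) (s N) x) /\
    sqn (axpy (-1) (s N) x) <= eps N.
Proof.
move=> eps0 s2 sC.
have csqC N M j : (N <= M)%N -> csq (s M j - s N j) <= eps N.
  move=> NM; apply: le_trans (sC _ _ NM).
  rewrite -[_ - _](_ : axpy (-1) (s N) (s M) j = _); last first.
    by rewrite /axpy scaleN1r addrC.
  by apply: csq_le_sqn; exact: l2_axpy.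
have cRe j i : cvgn (fun N => Re (s N j i 0)).
  apply: (cvg_sqdist eps0) => N M /csqC-/(_ j); apply: le_trans.
  rewrite /csq (bigD1 i) //= !mxE raddfB -addrA lerDl addr_ge0 ?sqr_ge0 //.
  by apply: sumr_ge0 => k _; rewrite addr_ge0 ?sqr_ge0.
have cIm j i : cvgn (fun N => Im (s N j i 0)).
  apply: (cvg_sqdist eps0) => N M /csqC-/(_ j); apply: le_trans.
  rewrite /csq (bigD1 i) //= !mxE [Im (_ - _)]raddfB addrAC lerDr addr_ge0 ?sqr_ge0 //.
  by apply: sumr_ge0 => k _; rewrite addr_ge0 ?sqr_ge0.
pose x : vseq R n := fun j =>
  \col_i (limn (fun N => Re (s N j i 0)) +i* limn (fun N => Im (s N j i 0))).
have xs N : l2 (axpy (-1) (s N) x) /\ sqn (axpy (-1) (s N) x) <= eps N.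
  apply: l2_bounded => J.
  have cv : (fun M => series (fun j => csq (axpy (-1) (s N) (s M) j)) J) @ \oo
      --> series (fun j => csq (axpy (-1) (s N) x j)) J.
    apply: cvg_sumR => j; apply: cvg_sumR => i; rewrite !mxE.
    under eq_fun do rewrite !mxE.
    have -> : (fun M => Re (-1 * s N j i 0 + s M j i 0) ^+ 2
          + Im (-1 * s N j i 0 + s M j i 0) ^+ 2) = (fun M =>
        (Re (s M j i 0) - Re (s N j i 0)) * (Re (s M j i 0) - Re (s N j i 0))
      + (Im (s M j i 0) - Im (s N j i 0)) * (Im (s M j i 0) - Im (s N j i 0))).
      by apply/funext => M; case: (s M j i 0) (s N j i 0) => a b [c d] /=; ring.
    set rl := limn _; set il := limn _.
    rewrite (_ : _ + _ = (rl - Re (s N j i 0)) * (rl - Re (s N j i 0))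
      + (il - Im (s N j i 0)) * (il - Im (s N j i 0))); last first.
      by case: (s N j i 0) => c d /=; ring.
    have crl : (fun M => Re (s M j i 0) - Re (s N j i 0)) @ \oo
        --> rl - Re (s N j i 0) by apply: cvgB; [exact: cRe|exact: cvg_cst].
    have cil : (fun M => Im (s M j i 0) - Im (s N j i 0)) @ \oo
        --> il - Im (s N j i 0) by apply: cvgB; [exact: cIm|exact: cvg_cst].
    by apply: cvgD; apply: cvgM.
  rewrite -(cvg_lim (@Rhausdorff R) cv); apply: limr_le.
    by apply/cvg_ex; eexists; exact: cv.
  exists N => // M /= NM; apply: le_trans (sC _ _ NM).
  by apply: sqn_ge; exact: l2_axpy.
exists x => //.
have -> : x = axpy 1 (s 0%N) (axpy (-1) (s 0%N) x).
  by apply/funext => j; rewrite /axpy scaleN1r scale1r addNKr.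
by apply: l2_axpy => //; case: (xs 0%N).
Qed.

End Completeness.

(** * Inversion of coercive operators *)

Section Bounded.
Variables (R : realType) (n : nat).

Lemma bounded_l2 m (T : vseq R n -> vseq R m) x : bounded_op T -> l2 x -> l2 (T x).
Proof. by case=> + _ _; apply. Qed.

Lemma bounded_axpy m (T : vseq R n -> vseq R m) a x y : bounded_op T ->
  l2 x -> l2 y -> T (axpy a x y) = axpy a (T x) (T y).
Proof. by case=> _ + _; apply. Qed.

Lemma bounded_sqn m (T : vseq R n -> vseq R m) : bounded_op T ->
  exists M, forall x, l2 x -> sqn (T x) <= M * sqn x.
Proof.
move=> bT; have [_ _ [M TM]] := bT; exists M => x x2.
have := TM x x2; rewrite (l2dotxx x2) (l2dotxx (bounded_l2 bT x2)).
by rewrite -lecR rmorphM.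
Qed.

End Bounded.

(* Comparing two sequences must not unfold the limits and the coordinates that
   they involve. *)
Local Opaque l2 l2dot sqn axpy.

Section Inversion.
Variables (R : realType) (n : nat).
Variables (A : vseq R n -> vseq R n) (delta : R).
Hypotheses (bA : bounded_op A) (delta0 : 0 < delta).
Hypothesis coA : forall x, l2 x -> delta * sqn x <= Re (l2dot (A x) x).

(** Expand 0 <= |A x - delta x|^2. *)
Lemma coercive_bounded_below x : l2 x -> delta ^+ 2 * sqn x <= sqn (A x).
Proof.
move=> x2; have Ax2 := bounded_l2 bA x2.
have := sqn_ge0 (@l2_axpy _ _ (- delta)%:C _ _ x2 Ax2).
rewrite sqn_axpy // (l2dotC Ax2 x2).
have -> : Re (Num.conj (l2dot (A x) x)) = Re (l2dot (A x) x) by case: (l2dot _ _).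
have : delta * (delta * sqn x) <= delta * Re (l2dot (A x) x).
  by rewrite ler_wpM2l ?coA // ltW.
move: (sqn x) (sqn (A x)) (Re _) => a b c; rewrite !expr2; lra.
Qed.

Lemma coercive_inj x y : l2 x -> l2 y -> A x = A y -> x = y.
Proof.
move=> x2 y2 Axy; have xy2 := @l2_axpy _ _ (-1) _ _ x2 y2.
have : axpy (-1) x y = fun=> 0.
  apply: sqn_eq0 => //; rewrite -(@pmulr_rle0 _ (delta ^+ 2)) ?exprn_gt0 //.
  apply: le_trans (coercive_bounded_below xy2) _.
  rewrite bounded_axpy // Axy.
  have -> : axpy (-1) (A y) (A y) = fun=> 0.
    by apply/funext => j; rewrite !axpyE scaleN1r addNr.
  by rewrite sqn0.
move=> xy0; apply/funext => j; apply/eqP; rewrite eq_sym -subr_eq0.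
by rewrite -[X in _ == X](congr1 (fun z : vseq R n => z j) xy0) axpyE scaleN1r addrC.
Qed.

(** With E = 1 - t A, the partial sums s_N = t (y + E y + .. + E^(N-1) y) of the
    Neumann series satisfy A s_N = y - E^N y.  Since |E x|^2 <= q |x|^2 for
    some q < 1, the images A s_N tend to y geometrically, and the lower bound
    on A turns this into convergence of the s_N themselves. *)
Lemma coercive_onto y : l2 y -> exists2 x, l2 x & A x = y.
Proof.
move=> y2; have [M0 AM0] := bounded_sqn bA.
pose M := `|M0| + delta ^+ 2; have d20 : 0 < delta ^+ 2 by rewrite exprn_gt0.
have M_gt0 : 0 < M by rewrite ltr_wpDl.
have AM x : l2 x -> sqn (A x) <= M * sqn x.
  move=> x2; apply: le_trans (AM0 x x2) _; rewrite ler_wpM2r ?sqn_ge0 //.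
  by rewrite (le_trans (ler_norm _)) // lerDl ltW.
(* |x - t A x|^2 <= (1 - 2 t delta + t^2 M) |x|^2, and this value of t minimizes
   the factor; M is taken at least delta^2 in order that q >= 0. *)
pose t := delta / M; pose q := 1 - delta ^+ 2 / M.
have q0 : 0 <= q by rewrite subr_ge0 ler_pdivrMr // mul1r lerDr.
have q1 : q < 1 by rewrite gtrBl divr_gt0.
have t0 : 0 <= t by rewrite divr_ge0 // ltW.
pose E x := axpy (- t)%:C (A x) x.
have E2 x : l2 x -> l2 (E x) by move=> x2; exact: l2_axpy (bounded_l2 bA x2) x2.
have Eq x : l2 x -> sqn (E x) <= q * sqn x.
  move=> x2; rewrite (sqn_axpy _ (bounded_l2 bA x2) x2).
  have -> : q * sqn x = t ^+ 2 * (M * sqn x) - 2 * t * (delta * sqn x) + sqn x.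
    by rewrite /q /t; field; rewrite gt_eqF.
  rewrite lerD2r mulrN mulNr sqrrN lerB //.
    by rewrite ler_wpM2l ?sqr_ge0 // AM.
  by rewrite ler_wpM2l ?coA // mulr_ge0.
pose e N := iter N E y.
have e2 N : l2 (e N) by elim: N => [|N IH]; [exact: y2|exact: E2 IH].
have e_le N : sqn (e N) <= q ^+ N * sqn y.
  elim: N => [|N IH]; first by rewrite mul1r.
  by rewrite exprS -mulrA; apply: le_trans (Eq _ (e2 N)) _; rewrite ler_wpM2l.
pose s := fix s N := if N is N'.+1 then axpy t%:C (e N') (s N') else fun=> 0.
have sS N : s N.+1 = axpy t%:C (e N) (s N) by [].
have s2 N : l2 (s N).
  by elim: N => [|N IH]; [exact: l2_0|exact: l2_axpy (e2 N) IH].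
have As N : A (s N) = axpy (-1) (e N) y.
  elim: N => [|N IH].
    have -> : s 0%N = axpy (-1) y y.
      by apply/funext => j; rewrite !axpyE scaleN1r addNr.
    rewrite bounded_axpy //; apply/funext => j.
    by rewrite !axpyE /= !scaleN1r !addNr.
  rewrite sS (bounded_axpy _ bA (e2 N) (s2 N)) IH.
  apply/funext => j; apply/matrixP => i k.
  rewrite /e iterS -/(e N) /E !axpyE !mxE.
  by rewrite (_ : (- t)%:C = - t%:C) ?rmorphN //; ring.
pose K := 4 * sqn y / delta ^+ 2.
have sC N N' : (N <= N')%N -> sqn (axpy (-1) (s N) (s N')) <= K * q ^+ N.
  move=> NN'; rewrite /K mulrAC ler_pdivlMr // mulrC.
  apply: le_trans (coercive_bounded_below (l2_axpy (s2 N) (s2 N'))) _.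
  rewrite (bounded_axpy _ bA (s2 N) (s2 N')) !As.
  have -> : axpy (-1) (axpy (-1) (e N) y) (axpy (-1) (e N') y)
      = axpy (-1) (e N') (e N).
    by apply/funext => j; apply/matrixP => i k; rewrite !axpyE !mxE; ring.
  apply: le_trans (sqnB_le (e2 N') (e2 N)) _.
  have q_mono : q ^+ N' <= q ^+ N by rewrite ler_wiXn2l // ltW.
  have := e_le N; have := e_le N'.
  have : q ^+ N' * sqn y <= q ^+ N * sqn y by rewrite ler_wpM2r // sqn_ge0.
  move: (sqn (e N)) (sqn (e N')) (q ^+ N) (q ^+ N') (sqn y) => a b c d f.
  lra.
have geo : (fun N => K * q ^+ N) @ \oo --> 0.
  by apply: (cvg_geometric K); rewrite ger0_norm.
have [x x2 xs] := l2_complete geo s2 sC; exists x => //.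
have Ax2 := bounded_l2 bA x2.
have d2 := @l2_axpy _ _ (-1) _ _ y2 Ax2.
have bnd N : sqn (axpy (-1) y (A x)) <= (2 * (M * K) + 2 * sqn y) * q ^+ N.
  have [xN2 xN] := xs N.
  have -> : axpy (-1) y (A x) = axpy (-1) (e N) (A (axpy (-1) (s N) x)).
    rewrite (bounded_axpy _ bA (s2 N) x2) As; apply/funext => j.
    by apply/matrixP => i k; rewrite !axpyE !mxE; ring.
  apply: le_trans (sqnB_le (e2 N) (bounded_l2 bA xN2)) _.
  have h1 := e_le N.
  have h2 : M * sqn (axpy (-1) (s N) x) <= M * (K * q ^+ N).
    by rewrite ler_wpM2l // ltW.
  have := AM _ xN2; move: h1 h2.
  move: (sqn (A _)) (sqn (e N)) (sqn (axpy _ _ _)) (q ^+ N) (sqn y) => a b c d f.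
  lra.
(* The bound tends to 0 with N while the left-hand side does not depend on N. *)
have y0 : sqn (axpy (-1) y (A x)) <= 0.
  have geo' := cvg_geometric (2 * (M * K) + 2 * sqn y) (_ : `|q| < 1).
  rewrite -(cvg_lim (@Rhausdorff R) (geo' _)) ?ger0_norm //.
  apply: limr_ge; last exact: nearW.
  by apply/cvg_ex; eexists; apply: geo'; rewrite ger0_norm.
have := sqn_eq0 d2 y0 => /(congr1 (fun z : vseq R n => z _)) Axy.
apply/funext => j; apply/eqP; rewrite -subr_eq0.
by rewrite -[X in _ == X](Axy j) axpyE scaleN1r addrC.
Qed.

Lemma coercive_inverse : exists B, is_inverse A B.
Proof.
have /choice[B AB] : forall y, exists x, l2 y -> l2 x /\ A x = y.
  move=> y; case: (pselect (l2 y)) => [/coercive_onto[x x2 Axy]|ny].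
    by exists x.
  by exists y => /ny.
have B2 y (y2 : l2 y) : l2 (B y) := (AB y y2).1.
have ABK y (y2 : l2 y) : A (B y) = y := (AB y y2).2.
have bB : bounded_op B.
  split; first exact: B2.
    move=> a x y x2 y2; have xy2 := @l2_axpy _ _ a _ _ x2 y2.
    apply: (coercive_inj (B2 _ xy2) (l2_axpy (B2 _ x2) (B2 _ y2))).
    by rewrite (bounded_axpy _ bA (B2 _ x2) (B2 _ y2)) !ABK.
  exists (delta ^- 2) => x x2.
  rewrite (l2dotxx x2) (l2dotxx (B2 _ x2)) -rmorphM lecR.
  rewrite mulrC ler_pdivlMr ?exprn_gt0 // mulrC.
  by rewrite (le_trans (coercive_bounded_below (B2 _ x2))) // ABK.
exists B; split; [exact: bA|exact: bB|move=> x x2].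
have Ax2 := bounded_l2 bA x2; split; first exact: ABK.
by apply: (coercive_inj (B2 _ Ax2) x2); exact: ABK.
Qed.

End Inversion.

(** * Matrices *)

Section Matrices.
Variable R : realType.
Local Notation C := R[i].

Lemma mx_ofE n m (f : 'cV[C]_n -> 'cV[C]_m) :
  (forall a v w, f (a *: v + w) = a *: f v + f w) ->
  forall v, mx_of f *m v = f v.
Proof.
move=> fL v; have f0 : f 0 = 0.
  have := fL (-1) 0 0; rewrite scaler0 addr0 scaleN1r => /eqP.
  by rewrite addrC subrr => /eqP.
have fD u w : f (u + w) = f u + f w by have := fL 1 u w; rewrite !scale1r.
have fZ a u : f (a *: u) = a *: f u by have := fL a u 0; rewrite !addr0 f0 addr0.
have {2}-> : v = \sum_j v j 0 *: delta_mx j 0.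
  by rewrite [LHS]matrix_sum_delta; apply: eq_bigr => j _; rewrite big_ord1.
rewrite (big_morph f fD f0); apply/matrixP => i k; rewrite ord1 mxE summxE.
by apply: eq_bigr => j _; rewrite fZ !mxE mulrC.
Qed.

Lemma eq_mulmx_col n m (A B : 'M[C]_(m, n)) :
  (forall v : 'cV_n, A *m v = B *m v) -> A = B.
Proof.
move=> AB; apply/matrixP => i j.
by have := congr1 (fun w : 'cV_m => w i 0) (AB (delta_mx j 0)); rewrite -!colE !mxE.
Qed.

Lemma gram_unit n m (A : 'M[C]_(m, n)) :
  (forall v : 'cV_n, A *m v = 0 -> v = 0) -> A^t* *m A \in unitmx.
Proof.
move=> A_inj; rewrite -unitmx_tr -row_free_unit; apply: inj_row_free => v.
move=> /(congr1 trmx); rewrite trmx_mul trmxK trmx0 -mulmxA => Av.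
apply: trmx_inj; rewrite trmx0; apply: A_inj; apply: csq_eq0; apply: complexI.
by rewrite -csqE trmx_mul map_mxM -mulmxA Av mulmx0 mxE.
Qed.

End Matrices.

(** * The shift and block Toeplitz operators *)

Section Shift.
Variables (R : realType).
Local Notation C := R[i].

Definition shift n (x : vseq R n) : vseq R n :=
  fun j => if j is j'.+1 then x j' else 0.

Definition bshift n (x : vseq R n) : vseq R n := fun j => x j.+1.

Lemma l2_shift n (x : vseq R n) : l2 x -> l2 (shift x).
Proof.
move=> x2; suff /l2_bounded[] : forall N,
    series (fun j => csq (shift x j)) N <= sqn x by [].
case=> [|N]; first by rewrite /series /= big_geq // sqn_ge0.
rewrite /series /= big_nat_recl //= csq0 add0r.
exact: sqn_ge.
Qed.

Lemma l2_bshift n (x : vseq R n) : l2 x -> l2 (bshift x).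
Proof.
move=> x2; suff /l2_bounded[] : forall N,
    series (fun j => csq (bshift x j)) N <= sqn x by [].
move=> N; apply: le_trans (sqn_ge N.+1 x2).
by rewrite /series /= big_nat_recl //= lerDr csq_ge0.
Qed.

Lemma l2dot_shift n (x y : vseq R n) : l2 x -> l2 y ->
  l2dot (shift x) y = l2dot x (bshift y).
Proof.
move=> x2 y2; apply: l2dot_lim; rewrite -cvg_shiftS.
rewrite (_ : [sequence _]_N = series (l2term x (bshift y))).
  exact: cvg_l2dot x2 (l2_bshift y2).
apply/funext => N; rewrite /series /= big_nat_recl //=.
by rewrite [X in X + _](_ : _ = 0) ?add0r // /l2term mulmx0 mxE.
Qed.

Variables (m p : nat) (F : nat -> 'M[C]_(m, p)).

Lemma toeplitz0 x : toeplitz F x 0%N = F 0%N *m x 0%N.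
Proof. by rewrite /toeplitz big_ord1 subnn. Qed.

Lemma toeplitz_shift x : toeplitz F (shift x) = shift (toeplitz F x).
Proof.
apply/funext => -[|i]; first by rewrite toeplitz0 mulmx0.
by rewrite /toeplitz big_ord_recl /= mulmx0 add0r.
Qed.

End Shift.

(** * Adjoints and inverses *)

Section Adjoint.
Variable R : realType.

Lemma adjointP n m (T : vseq R n -> vseq R m) :
  (exists S, is_adjoint T S) -> is_adjoint T (adjoint T).
Proof.
by move=> h; rewrite /adjoint; case: pselect => [h'|/(_ h)[]]; exact: (svalP (cid h')).
Qed.

Lemma inverseP n (A : vseq R n -> vseq R n) :
  (exists B, is_inverse A B) -> is_inverse A (inverse A).
Proof.
by move=> h; rewrite /inverse; case: pselect => [h'|/(_ h)[]]; exact: (svalP (cid h')).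
Qed.

Lemma emb_lin n a (v w : 'cV[R[i]]_n) : emb n (a *: v + w) = axpy a (emb n v) (emb n w).
Proof. by apply/funext => -[|j]; rewrite axpyE //= scaler0 addr0. Qed.

Lemma strictly_positive_coercive n (A : vseq R n -> vseq R n) :
  strictly_positive A -> bounded_op A /\ exists2 delta : R, 0 < delta &
    forall x, l2 x -> delta * sqn x <= Re (l2dot (A x) x).
Proof.
move=> [[bA _ _] [delta d0 Ad]]; split; [exact: bA|exists delta; [exact: d0|move=> x x2]].
have := Ad x x2; rewrite (l2dotxx x2) -rmorphM lecE => /andP[_ H].
exact: H.
Qed.

(** Without an adjoint, [T \o adjoint T] is the constant T 0, which is 0 by
    linearity; strict positivity then leaves no nonzero vector in the target, and
    over such a target the zero operator is an adjoint of T. *)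
Lemma strictly_positive_adjoint n m (T : vseq R n -> vseq R m) :
  strictly_positive (T \o adjoint T) -> is_adjoint T (adjoint T).
Proof.
move=> /strictly_positive_coercive[bA [delta d0 Ad]]; apply: adjointP.
apply: contrapT => nadj.
have adj0 : adjoint T = fun _ _ => 0.
  by rewrite /adjoint; case: pselect => [h|_]; [case: (nadj h)|].
have T0 : T (fun=> 0) = fun=> 0.
  have := bounded_axpy (-1) bA (@l2_emb R m 0) (@l2_emb R m 0).
  rewrite /= adj0 => E.
  by rewrite [LHS]E; apply/funext => j; rewrite axpyE scaleN1r addNr.
have v0 (v : 'cV[R[i]]_m) : v = 0.
  have := Ad _ (@l2_emb R m v); rewrite /= adj0 T0 l2dot0l pmulr_rle0 //.
  move=> /(sqn_eq0 (@l2_emb R m v)).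
  exact: (congr1 (fun x : vseq R m => x 0%N)).
have z0 (y : vseq R m) : y = fun=> 0 by apply/funext => j; exact: v0.
apply: nadj; exists (fun _ _ => 0); split.
- split=> [x x2|a x y x2 y2|].
  + by rewrite (z0 (T x)); exact: l2_0.
  + exact: etrans (z0 _) (esym (z0 _)).
  + by exists 0 => x x2; rewrite (z0 (T x)) (l2dotxx (@l2_0 _ _)) sqn0 mul0r.
- split=> [x x2|a x y x2 y2|].
  + exact: l2_0.
  + by apply/funext => j; rewrite scaler0 addr0.
  + by exists 0 => x x2; rewrite (l2dotxx (@l2_0 _ _)) sqn0 mul0r.
- by move=> x y x2 y2; rewrite [T x]z0 l2dot0l l2dot0r.
Qed.

End Adjoint.

Section Gramian.
Variables (R : realType) (m p : nat) (T : vseq R p -> vseq R m).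
Hypothesis posT : strictly_positive (T \o adjoint T).

Lemma bounded_base : bounded_op T.
Proof. by have [] := strictly_positive_adjoint posT. Qed.

Lemma bounded_adjoint : bounded_op (adjoint T).
Proof. by have [] := strictly_positive_adjoint posT. Qed.

Lemma l2dot_adjoint x y : l2 x -> l2 y -> l2dot (T x) y = l2dot x (adjoint T y).
Proof. by move=> x2 y2; have [_ _ ->] := strictly_positive_adjoint posT. Qed.

Lemma inverse_gramian : is_inverse (T \o adjoint T) (inverse (T \o adjoint T)).
Proof.
have [bA [delta d0 Ad]] := strictly_positive_coercive posT.
by apply: inverseP; exact: coercive_inverse bA d0 Ad.
Qed.

Lemma bounded_inverse : bounded_op (inverse (T \o adjoint T)).
Proof. by have [] := inverse_gramian. Qed.

Lemma gramianK x : l2 x -> T (adjoint T (inverse (T \o adjoint T) x)) = x.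
Proof. by move=> x2; have [_ _ /(_ x x2)[]] := inverse_gramian. Qed.

End Gramian.

(** * Coordinate zero of a strictly positive Toeplitz operator *)

Section ToeplitzGramian.
Variables (R : realType) (m p : nat) (F : nat -> 'M[R[i]]_(m, p)).
Local Notation C := R[i].
Local Notation T := (toeplitz F).
Local Notation Ts := (adjoint T).
Local Notation B := (inverse (T \o Ts)).
Local Notation F0 := (F 0%N).
Local Notation Xi := (mx_of (proj0 p \o Ts \o B \o emb m)).
Local Notation Q := (mx_of (proj0 p \o Ts \o B \o T \o emb p)).
Hypothesis posT : strictly_positive (T \o Ts).
Let bT := bounded_base posT.
Let bTs := bounded_adjoint posT.
Let bB := bounded_inverse posT.

(** For w = S^* z, one has
    <A w, w> = <S T T^* w, z> = <T S T^* w, z> = <S T^* w, T^* z>, and the last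
    product vanishes because S T^* w has zero first coordinate and T^* z has
    no other.  Strict positivity then gives w = 0. *)
Lemma embedded_adjoint_preimage z (u : 'cV[C]_p) : l2 z -> Ts z = emb p u ->
  z = emb m (z 0%N).
Proof.
move=> z2 Tsz; have [_ [delta d0 Ad]] := strictly_positive_coercive posT.
have w2 := l2_bshift z2; set w := bshift z in w2.
have Tw2 := bounded_l2 bTs w2; have TTw2 := bounded_l2 bT Tw2.
have : delta * sqn w <= 0.
  apply: le_trans (Ad w w2) _.
  rewrite /= -(l2dot_shift TTw2 z2) -toeplitz_shift.
  rewrite (l2dot_adjoint posT (l2_shift Tw2) z2) Tsz l2dot_embr mulmx0 mxE.
  exact: lexx.
rewrite pmulr_rle0 // => /(sqn_eq0 w2) w0.
apply/funext => -[|j]; first by [].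
exact: (congr1 (fun x : vseq R m => x j) w0).
Qed.

(** |u|^2 = <E u, T^* z> = <T E u, E z_0> = <F_0 u, z_0>. *)
Lemma ker_adjoint_range z (u : 'cV[C]_p) : l2 z -> Ts z = emb p u ->
  F0 *m u = 0 -> u = 0.
Proof.
move=> z2 Tsz Fu; have zE := embedded_adjoint_preimage z2 Tsz.
apply: csq_eq0; apply: complexI; rewrite -csqE.
rewrite -[X in _ *m X]/(emb p u 0%N) -l2dot_embr -{2}Tsz.
rewrite -(l2dot_adjoint posT (@l2_emb _ _ u) z2) zE l2dot_embr toeplitz0 /=.
by rewrite Fu mulmx0 mxE.
Qed.

Lemma XiE v : Xi *m v = Ts (B (emb m v)) 0%N.
Proof.
apply: mx_ofE => a {}v w /=; rewrite emb_lin /proj0.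
have v2 := @l2_emb _ _ v; have w2 := @l2_emb _ _ w.
rewrite (bounded_axpy _ bB v2 w2).
by rewrite (bounded_axpy _ bTs (bounded_l2 bB v2) (bounded_l2 bB w2)) axpyE.
Qed.

Lemma QE v : Q *m v = Ts (B (T (emb p v))) 0%N.
Proof.
apply: mx_ofE => a {}v w /=; rewrite emb_lin /proj0.
have v2 := @l2_emb _ _ v; have w2 := @l2_emb _ _ w.
have Tv2 := bounded_l2 bT v2; have Tw2 := bounded_l2 bT w2.
rewrite (bounded_axpy _ bT v2 w2) (bounded_axpy _ bB Tv2 Tw2).
by rewrite (bounded_axpy _ bTs (bounded_l2 bB Tv2) (bounded_l2 bB Tw2)) axpyE.
Qed.

Lemma taylor0_Xi : F0 *m Xi = 1%:M.
Proof.
apply: eq_mulmx_col => v; rewrite -mulmxA XiE -toeplitz0 (gramianK posT) ?mul1mx //.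
exact: l2_emb.
Qed.

Lemma taylor0_Q : F0 *m Q = F0.
Proof.
apply: eq_mulmx_col => u; rewrite -mulmxA QE -toeplitz0 (gramianK posT).
  by rewrite toeplitz0.
exact: bounded_l2 bT (@l2_emb _ _ u).
Qed.

(** The hypothesis says <w, E u> = 0 for w = E u - T^* z, z = A^-1 T E u.  As
    T w = 0, also <w, T^* z> = 0, hence w = 0 and E u = T^* z. *)
Lemma defect_inj (u : 'cV[C]_p) :
  F0 *m u = 0 -> (u^t* *m (1%:M - Q) *m u) 0 0 = 0 -> u = 0.
Proof.
move=> Fu uQu; have u2 := @l2_emb _ _ u.
have Tu2 := bounded_l2 bT u2; have z2 := bounded_l2 bB Tu2.
set z := B (T (emb p u)) in z2; have Tsz2 := bounded_l2 bTs z2.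
have w2 := @l2_axpy _ _ (-1) _ _ Tsz2 u2.
set w := axpy (-1) (Ts z) (emb p u) in w2.
have Tw : T w = fun=> 0.
  rewrite (bounded_axpy _ bT Tsz2 u2) (gramianK posT Tu2).
  by apply/funext => j; rewrite axpyE scaleN1r addNr.
have ww : sqn w <= 0.
  rewrite -lecR -(l2dotxx w2) {2}/w (l2dot_axpyr _ Tsz2 u2 w2).
  rewrite -(l2dot_adjoint posT w2 z2) Tw l2dot0l mulr0 add0r l2dot_embr.
  rewrite (_ : w 0%N = (1%:M - Q) *m u); first by rewrite mulmxA uQu.
  by rewrite mulmxBl mul1mx QE /w axpyE scaleN1r addrC.
apply: (ker_adjoint_range z2 _ Fu); apply/funext => j.
have := congr1 (fun x : vseq R p => x j) (sqn_eq0 w2 ww).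
by rewrite /w axpyE scaleN1r addrC => /eqP; rewrite subr_eq0 => /eqP.
Qed.

End ToeplitzGramian.

(** * Completion of a right inverse to an invertible matrix *)

Section Completion.
Variables (R : realType) (m p k : nat).
Local Notation C := R[i].
Variables (F0 : 'M[C]_(m, p)) (Xi : 'M[C]_(p, m)) (Th : 'M[C]_(p, k)).
Hypotheses (F0Xi : F0 *m Xi = 1%:M) (F0Th : F0 *m Th = 0).
Hypothesis gram : Th^t* *m Th \in unitmx.
Hypothesis defect : forall u : 'cV_p, F0 *m u = 0 -> Th^t* *m u = 0 -> u = 0.
Local Notation L := (invmx (Th^t* *m Th) *m Th^t*).
Local Notation H0 := (L *m (1%:M - Xi *m F0)).

Lemma gram_left_inverse : L *m Th = 1%:M.
Proof. by rewrite -mulmxA mulVmx. Qed.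

(** Th L is the orthogonal projection onto the range of Th, so u - Th L u is
    orthogonal to that range, while it stays in the kernel of F0. *)
Lemma ker_projection (u : 'cV_p) : F0 *m u = 0 -> Th *m (L *m u) = u.
Proof.
move=> Fu; apply/eqP; rewrite eq_sym -subr_eq0; apply/eqP; apply: defect.
  by rewrite mulmxBr Fu mulmxA F0Th mul0mx subr0.
by rewrite mulmxBr !mulmxA mulmxV // mul1mx subrr.
Qed.

Lemma row_mul_col : row_mx Xi Th *m col_mx F0 H0 = 1%:M.
Proof.
rewrite mul_row_col; apply: eq_mulmx_col => u.
rewrite mulmxDl -(mulmxA Th) -(mulmxA L) ker_projection.
  by rewrite mulmxBl addrC subrK.
by rewrite mulmxA mulmxBr mulmx1 mulmxA F0Xi mul1mx subrr mul0mx.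
Qed.

Lemma col_mul_row : col_mx F0 H0 *m row_mx Xi Th = 1%:M.
Proof.
rewrite mul_col_row F0Xi F0Th -!(mulmxA L) !mulmxBl !mul1mx -!(mulmxA Xi) F0Xi F0Th.
by rewrite mulmx1 subrr !mulmx0 subr0 gram_left_inverse scalar_mx_block.
Qed.

Lemma completion_size : (m <= p)%N /\ k = (p - m)%N.
Proof.
have h1 := mulmx1_min row_mul_col; have h2 := mulmx1_min col_mul_row.
have mkp : (m + k)%N = p by apply/eqP; rewrite eqn_leq h1 h2.
by rewrite -mkp leq_addr addKn.
Qed.

Lemma range_eq_ker (u : 'cV_p) : (exists v : 'cV_k, u = Th *m v) <-> F0 *m u = 0.
Proof.
split=> [[v ->]|Fu]; first by rewrite mulmxA F0Th mul0mx.
by exists (L *m u); rewrite ker_projection.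
Qed.

End Completion.

Theorem lemma2p1 (R : realType) (m p k : nat)
    (G : R[i] -> 'M[R[i]]_(m, p)) (Theta0 : 'M[R[i]]_(p, k)) :
  let TG := toeplitz (taylor G) in
  let TGs := adjoint TG in
  let TTinv := inverse (TG \o TGs) in
  let G0 := taylor G 0 in
  let Xi0 := mx_of (proj0 p \o TGs \o TTinv \o emb m) in
  let H0 := invmx (Theta0^t* *m Theta0) *m Theta0^t* *m (1%:M - Xi0 *m G0) in
  Hinfty G ->
  strictly_positive (TG \o TGs) ->
  Theta0 *m Theta0^t* =
    1%:M - mx_of (proj0 p \o TGs \o TTinv \o TG \o emb p) ->
  (forall v : 'cV_k, Theta0 *m v = 0 -> v = 0) ->
  [/\ Theta0^t* *m Theta0 \in unitmx,
      row_mx Xi0 Theta0 *m col_mx G0 H0 = 1%:M,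
      col_mx G0 H0 *m row_mx Xi0 Theta0 = 1%:M,
      (m <= p)%N /\ k = (p - m)%N &
      forall u : 'cV_p, (exists v : 'cV_k, u = Theta0 *m v) <-> G0 *m u = 0].
Proof.
move=> TG TGs TTinv G0 Xi0 H0 _ posT ThTh Th_inj.
have gram := gram_unit Th_inj.
have G0Xi : G0 *m Xi0 = 1%:M by exact: taylor0_Xi posT.
have G0Th : G0 *m Theta0 = 0.
  have E : G0 *m Theta0 *m Theta0^t* = 0.
    by rewrite -mulmxA ThTh mulmxBr mulmx1 (taylor0_Q posT) subrr.
  by rewrite -[LHS](mulmxK gram) mulmxA E !mul0mx.
have defect (u : 'cV_p) : G0 *m u = 0 -> Theta0^t* *m u = 0 -> u = 0.
  move=> Gu Thu; apply: (defect_inj posT Gu).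
  by rewrite -ThTh -!mulmxA Thu !mulmx0 mxE.
split.
- exact: gram.
- exact: row_mul_col.
- exact: col_mul_row.
- exact: completion_size G0Xi G0Th gram defect.
- exact: range_eq_ker.
Qed.
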